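(* Let $\mathbb{A}\in\mathbb{C}^{n\times n}$, let $\mathbf{X}_m,\mathbf{Y}_m\in\mathbb{C}^{n\times m}$ ($m\le n$) satisfy $\mathbf{Y}_m=\mathbb{A}\mathbf{X}_m$, let $\mathbf{X}_m=U\Sigma V^*$ be a thin singular value decomposition, let $k\in\{1,\ldots,m\}$ be such that $\sigma_k>0$, and let $U_k,V_k,\Sigma_k$ be its truncation to the $k$ largest singular values. Let $S_k=U_k^*\mathbf{Y}_mV_k\Sigma_k^{-1}$, and let $(\lambda_i,W_k(:,i))$, $i=1,\ldots,k$, be the computed eigenpairs of $S_k$: $S_kW_k(:,i)=\lambda_iW_k(:,i)$, $\|W_k(:,i)\|_2=1$. Set $Z_k=U_kW_k$. Then for the Ritz pairs $(\lambda_i,Z_k(:,i)\equiv U_kW_k(:,i))$, $i=1,\ldots,k$, the residual norms can be computed as $$r_k(i)=\|\mathbb{A}(U_kW_k(:,i))-\lambda_i(U_kW_k(:,i))\|_2=\|(\mathbf{Y}_mV_k\Sigma_k^{-1})W_k(:,i)-\lambda_iZ_k(:,i)\|_2 .$$ Further, if $\mathbb{A}=S\,\mathrm{diag}(\alpha_1,\ldots,\alpha_n)\,S^{-1}$, then for each $i$, $\min_{j}|\lambda_i-\alpha_j|\le\kappa_2(S)\,r_k(i)$.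
   Context: Thin SVD: $U\in\mathbb{C}^{n\times m}$ has orthonormal columns, $V\in\mathbb{C}^{m\times m}$ is unitary, $\Sigma=\mathrm{diag}(\sigma_1,\ldots,\sigma_m)$ with $\sigma_1\ge\cdots\ge\sigma_m\ge0$. $U_k,V_k$ consist of the first $k$ columns of $U,V$, and $\Sigma_k=\mathrm{diag}(\sigma_1,\ldots,\sigma_k)$. $M(:,i)$ denotes the $i$-th column of a matrix $M$; $W_k\in\mathbb{C}^{k\times k}$ has columns $W_k(:,i)$. $\|\cdot\|_2$ is the Euclidean vector norm and the induced operator norm, and $\kappa_2(S)=\|S\|_2\|S^{-1}\|_2$. All quantities are in exact arithmetic. *)

(* Defs.v *)
From HB Require Import structures.
From mathcomp Require Import all_boot all_order all_algebra.
From mathcomp Require Import complex.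
From mathcomp Require Import boolp classical_sets reals constructive_ereal.

Set Implicit Arguments.
Unset Strict Implicit.
Unset Printing Implicit Defensive.

Import Order.TTheory GRing.Theory Num.Theory.
Import ComplexField.

Local Open Scope classical_set_scope.
Local Open Scope complex_scope.
Local Open Scope sesquilinear_scope.
Local Open Scope ring_scope.

(* The complex field is R[i] with R a realType.  All norms take values in R
   (Normc.normc : R[i] -> R is the modulus), because the library norm `|z| of
   R[i] is itself an element of R[i]. *)

Definition norm2 (R : realType) (n : nat) (x : 'cV[R[i]]_n) : R :=
  Num.sqrt (\sum_i Normc.normc (x i ord0) ^+ 2).

Definition opnorm2 (R : realType) (m n : nat) (M : 'M[R[i]]_(m, n)) : R :=
  sup [set norm2 (M *m x) | x in [set x : 'cV[R[i]]_n | norm2 x = 1]].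

Definition kappa2 (R : realType) (n : nat) (S : 'M[R[i]]_n) : R :=
  opnorm2 S * opnorm2 (invmx S).

Definition diagC (R : realType) (m : nat) (s : 'rV[R]_m) : 'M[R[i]]_m :=
  diag_mx (map_mx (real_complex R) s).

(* unitarymx constrains the rows (X *m X^t* = 1), hence the explicit equation
   for the orthonormality of the columns of the rectangular factor U. *)
Definition thin_svd (R : realType) (n m : nat) (X U : 'M[R[i]]_(n, m))
    (sigma : 'rV[R]_m) (V : 'M[R[i]]_m) : Prop :=
  [/\ X = U *m diagC sigma *m V^t*,
      U^t* *m U = 1%:M,
      V \is unitarymx,
      (forall i j : 'I_m, (i <= j)%N -> sigma 0 j <= sigma 0 i) &
      (forall i : 'I_m, 0 <= sigma 0 i)].

Definition first_cols (T : Type) (n k m : nat) (le_km : (k <= m)%N)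
    (M : 'M[T]_(n, m)) : 'M[T]_(n, k) :=
  colsub (widen_ord le_km) M.

(* The minimum of a finite family of reals, taken in the extended reals so that
   +oo is neutral; for 0 < n it is the usual (finite) minimum. *)
Definition min_dist (R : realType) (n : nat) (z : R[i]) (a : 'rV[R[i]]_n) :
    \bar R :=
  \big[Order.min/+oo%E]_(j < n) (Normc.normc (z - a 0 j))%:E.

(* Main.v *)
Require Import Defs.
From HB Require Import structures.
From mathcomp Require Import all_boot all_order all_algebra.
From mathcomp Require Import complex.
From mathcomp Require Import boolp classical_sets reals constructive_ereal.

Import Order.TTheory GRing.Theory Num.Theory.

Local Open Scope complex_scope.
Local Open Scope sesquilinear_scope.
Local Open Scope ring_scope.

(** The truncated factors satisfy X V_k = U_k Sigma_k, because V is
    unitary; as Sigma_k is invertible, U_k = X V_k Sigma_k^-1 (svd_truncation),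
    and Y = A X gives A U_k = Y V_k Sigma_k^-1.  This identity turns the residual,
    which involves the action of A on the Ritz vectors, into an expression in
    the data Y alone, and that is the first claim.

    The second claim is the residual form of the Bauer-Fike theorem
    (bauer_fike_residual).  If A = S D S^-1 and y = S^-1 z, the residual
    satisfies S^-1 (A z - l z) = (D - l) y, and the diagonal matrix D - l
    stretches every vector at least by d, the distance from l to the spectrum.
    Thus d |y| <= |S^-1| |A z - l z|, while |z| <= |S| |y|; multiplying the two
    bounds gives d |z| <= kappa(S) |A z - l z|.  The Ritz vectors U_k w have
    norm 1 because U_k has orthonormal columns (norm2_isometry).

    The operator norm is a supremum of real numbers, so the compatibility
    |M x| <= |M| |x| requires that the supremum range over a bounded set
    (has_ubound_opnorm2). *)

(** * The Euclidean norm *)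

Section SpectralBounds.
Set Implicit Arguments.
Unset Strict Implicit.
Variable R : realType.
Local Notation normc := (@Normc.normc R).
Local Notation norm2 := (@norm2 R _).

Lemma normc_ge0 (z : R[i]) : 0 <= normc z.
Proof. by case: z => a b; exact: sqrtr_ge0. Qed.

Lemma normc_sum (I : finType) (F : I -> R[i]) :
  normc (\sum_i F i) <= \sum_i normc (F i).
Proof.
elim/big_ind2: _ => [|x1 y1 x2 y2 h1 h2|//]; first by rewrite Normc.normc0.
by apply: le_trans (le_normcD _ _) _; exact: lerD.
Qed.

Lemma norm2_ge0 n (x : 'cV[R[i]]_n) : 0 <= norm2 x.
Proof. exact: sqrtr_ge0. Qed.

Lemma sqr_norm2 n (x : 'cV[R[i]]_n) :
  norm2 x ^+ 2 = \sum_i normc (x i ord0) ^+ 2.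
Proof. by rewrite sqr_sqrtr// sumr_ge0// => i _; rewrite sqr_ge0. Qed.

Lemma norm2_inner n (x : 'cV[R[i]]_n) :
  (norm2 x ^+ 2)%:C = (x^t* *m x) ord0 ord0.
Proof.
rewrite sqr_norm2 rmorph_sum/= mxE; apply: eq_bigr => i _.
rewrite !mxE rmorphXn/= mulrC; exact: (sqr_normc (x i ord0)).
Qed.

Lemma norm2Z n (c : R[i]) (x : 'cV[R[i]]_n) :
  norm2 (c *: x) = normc c * norm2 x.
Proof.
apply/eqP; rewrite -(@eqrXn2 _ 2) ?norm2_ge0 ?mulr_ge0 ?normc_ge0 ?norm2_ge0//.
rewrite exprMn !sqr_norm2 mulr_sumr; apply/eqP/eq_bigr => i _.
by rewrite mxE Normc.normcM exprMn.
Qed.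

Lemma norm2_eq0 n (x : 'cV[R[i]]_n) : norm2 x = 0 -> x = 0.
Proof.
move=> x0; apply/colP => i; rewrite mxE; apply: Normc.eq0_normc.
apply/eqP; rewrite -sqrf_eq0; apply/eqP; move: i isT.
apply: psumr_eq0P => [i _|]; first exact: sqr_ge0.
by rewrite -sqr_norm2 x0 expr0n.
Qed.

Lemma normc_coord n (x : 'cV[R[i]]_n) i : normc (x i ord0) <= norm2 x.
Proof.
rewrite -(@ler_pXn2r _ 2) ?nnegrE ?normc_ge0 ?norm2_ge0// sqr_norm2.
by rewrite (bigD1 i)//= lerDl sumr_ge0// => j _; rewrite sqr_ge0.
Qed.

(** The squared norm is the Hermitian square x^* x, which U preserves. *)
Lemma norm2_isometry n k (U : 'M[R[i]]_(n, k)) (x : 'cV[R[i]]_k) :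
  U^t* *m U = 1%:M -> norm2 (U *m x) = norm2 x.
Proof.
move=> UU; apply/eqP; rewrite -(@eqrXn2 _ 2) ?norm2_ge0//; apply/eqP.
apply: (@complexI R); rewrite !norm2_inner trmx_mul map_mxM -mulmxA.
by rewrite [_ *m (U *m x)]mulmxA UU mul1mx.
Qed.

(** * The operator norm *)

(** On the unit sphere all coordinates have modulus at most 1, so the entries
    of M x are bounded by the row sums of the moduli of M. *)
Lemma has_ubound_opnorm2 m n (M : 'M[R[i]]_(m, n)) :
  has_ubound [set norm2 (M *m x) | x in [set x : 'cV[R[i]]_n | norm2 x = 1]].
Proof.
exists (Num.sqrt (\sum_i (\sum_j normc (M i j)) ^+ 2)) => _ [x /= x1 <-].
apply: ler_wsqrtr; apply: ler_sum => i _.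
rewrite ler_pXn2r ?nnegrE ?normc_ge0 ?sumr_ge0//; last first.
  by move=> j _; exact: normc_ge0.
rewrite mxE; apply: le_trans (normc_sum _) _; apply: ler_sum => j _.
by rewrite Normc.normcM ler_piMr ?normc_ge0// -x1 normc_coord.
Qed.

Lemma opnorm2_ge0 m n (M : 'M[R[i]]_(m, n)) : 0 <= opnorm2 M.
Proof.
have ub := has_ubound_opnorm2 M; rewrite /opnorm2.
set E := (X in sup X); rewrite -/E in ub *.
(* for n = 0 the unit sphere is empty and the supremum is 0 by convention *)
have [->|/set0P[_ [x x1 _]]] := eqVneq E classical_sets.set0.
  by rewrite sup0.
by apply: (le_trans (norm2_ge0 (M *m x))); apply: (ub_le_sup ub); exists x.
Qed.

Lemma norm2_mul_le m n (M : 'M[R[i]]_(m, n)) (x : 'cV[R[i]]_n) :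
  norm2 (M *m x) <= opnorm2 M * norm2 x.
Proof.
have [x0|x0] := eqVneq (norm2 x) 0.
  rewrite (norm2_eq0 x0) mulmx0 -{1}(scale0r (0 : 'cV[R[i]]_m)) norm2Z.
  by rewrite Normc.normc0 mul0r mulr_ge0 ?opnorm2_ge0 ?norm2_ge0.
pose c : R[i] := ((norm2 x)^-1)%:C.
have c_norm : normc c = (norm2 x)^-1.
  by rewrite /= expr0n addr0 sqrtr_sqr ger0_norm// invr_ge0 norm2_ge0.
have le_sup : norm2 (M *m (c *: x)) <= opnorm2 M.
  apply: (ub_le_sup (has_ubound_opnorm2 M)); exists (c *: x) => //=.
  by rewrite norm2Z c_norm mulVf.
by rewrite -ler_pdivrMr ?lt_def ?x0 ?norm2_ge0// mulrC -c_norm -norm2Z scalemxAr.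
Qed.

(** * The Bauer-Fike bound *)

Lemma norm2_diag_ge n (d : R) (a : 'rV[R[i]]_n) (x : 'cV[R[i]]_n) :
  0 <= d -> (forall j, d <= normc (a ord0 j)) ->
  d * norm2 x <= norm2 (diag_mx a *m x).
Proof.
move=> d0 da; rewrite -(@ler_pXn2r _ 2) ?nnegrE ?mulr_ge0 ?norm2_ge0//.
rewrite exprMn !sqr_norm2 mulr_sumr; apply: ler_sum => i _.
rewrite mul_diag_mx mxE Normc.normcM exprMn ler_wpM2r ?sqr_ge0//.
by rewrite ler_pXn2r// nnegrE normc_ge0.
Qed.

(** Transporting the residual by S^-1 diagonalizes the problem; passing back and
    forth between z and S^-1 z costs the two factors of kappa2 S. *)
Lemma bauer_fike_residual n (S : 'M[R[i]]_n) (alpha : 'rV[R[i]]_n)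
    (l : R[i]) (d : R) (z : 'cV[R[i]]_n) :
  S \in unitmx -> 0 <= d -> (forall j, d <= normc (l - alpha ord0 j)) ->
  d * norm2 z
    <= kappa2 S * norm2 (S *m diag_mx alpha *m invmx S *m z - l *: z).
Proof.
move=> Su d0 dle; set A := S *m _ *m _; pose y := invmx S *m z.
have zE : z = S *m y by rewrite mulKVmx.
have resE : diag_mx (alpha - const_mx l) *m y = invmx S *m (A *m z - l *: z).
  rewrite linearB/= mulmxBl diag_const_mx mul_scalar_mx mulmxBr -scalemxAr.
  by rewrite -!mulmxA mulKmx.
have ge_d : d * norm2 y <= norm2 (diag_mx (alpha - const_mx l) *m y).
  by apply: norm2_diag_ge => // j; rewrite !mxE -normcN opprB.
have z_le : d * norm2 z <= opnorm2 S * (d * norm2 y).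
  by rewrite mulrCA ler_wpM2l// {1}zE norm2_mul_le.
apply: (le_trans z_le); rewrite -mulrA ler_wpM2l ?opnorm2_ge0//.
by rewrite (le_trans ge_d)// resE norm2_mul_le.
Qed.

(** For 0 < n the minimum is attained, hence it is one of the admissible real
    lower bounds d; for n = 0 it would be +oo. *)
Lemma min_dist_le n (l : R[i]) (a : 'rV[R[i]]_n) (x : R) :
  (0 < n)%N ->
  (forall d, 0 <= d -> (forall j, d <= normc (l - a ord0 j)) -> d <= x) ->
  (min_dist l a <= x%:E)%E.
Proof.
move=> n0 h; pose f j := normc (l - a ord0 j).
case: (arg_minP (i0 := Ordinal n0) (P := xpredT) f isT) => j _ fj.
apply: (le_trans (bigmin_le _ j _)); rewrite lee_fin.
by apply: h => [|i]; [exact: normc_ge0|exact: fj].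
Qed.

(** * Truncation of the singular value decomposition *)

Lemma diagC_unit k (s : 'rV[R]_k) :
  (forall i, 0 < s ord0 i) -> diagC s \in unitmx.
Proof.
move=> s0; rewrite unitmxE det_diag unitfE; apply/prodf_neq0 => i _.
by rewrite mxE; apply: contra_neq (lt0r_neq0 (s0 i)) => -[].
Qed.

(** The Gram matrix of the selected columns is a principal submatrix of the Gram
    matrix of M, hence of the identity. *)
Lemma first_cols_isometry n m k (le_km : (k <= m)%N) (M : 'M[R[i]]_(n, m)) :
  M^t* *m M = 1%:M -> (first_cols le_km M)^t* *m first_cols le_km M = 1%:M.
Proof.
move=> MM; apply/matrixP => i j.
have /matrixP/(_ (widen_ord le_km i) (widen_ord le_km j)) := MM.
by rewrite !mxE => <-; apply: eq_bigr => l _; rewrite !mxE.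
Qed.

(** Unitarity of V gives X V = U Sigma; the first k columns of U Sigma involve
    only the leading part of Sigma because Sigma is diagonal. *)
Lemma svd_mul_first_cols n m k (le_km : (k <= m)%N)
    (X U : 'M[R[i]]_(n, m)) (sigma : 'rV[R]_m) (V : 'M[R[i]]_m) :
  thin_svd X U sigma V ->
  X *m first_cols le_km V
    = first_cols le_km U *m diagC (first_cols le_km sigma).
Proof.
move=> [-> _ Vu _ _]; rewrite /first_cols mulmx_colsub mulmxKtV//.
by rewrite /diagC !mul_mx_diag; apply/matrixP => i j; rewrite !mxE.
Qed.

Lemma svd_truncation n m k (le_km : (k <= m)%N)
    (X U : 'M[R[i]]_(n, m)) (sigma : 'rV[R]_m) (V : 'M[R[i]]_m) :
  thin_svd X U sigma V -> (forall j : 'I_m, j.+1 = k -> 0 < sigma ord0 j) ->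
  X *m first_cols le_km V *m invmx (diagC (first_cols le_km sigma))
    = first_cols le_km U.
Proof.
move=> svdX sk0; rewrite (svd_mul_first_cols _ svdX) mulmxK//.
apply: diagC_unit => i; rewrite mxE; case: svdX => _ _ _ decr _.
have k0 : (0 < k)%N by exact: leq_ltn_trans (ltn_ord i).
have lt_k1m : (k.-1 < m)%N by rewrite prednK.
(* the smallest retained singular value has the 0-based index k - 1 *)
apply: (lt_le_trans (sk0 (Ordinal lt_k1m) (prednK k0))).
by apply: decr; rewrite /= -ltnS prednK.
Qed.

End SpectralBounds.

(** * Ritz residuals *)

Theorem proposition3p2 (R : realType) (n m : nat) (le_mn : (m <= n)%N)
    (A : 'M[R[i]]_n) (X Y : 'M[R[i]]_(n, m)) (hY : Y = A *m X)
    (U : 'M[R[i]]_(n, m)) (sigma : 'rV[R]_m) (V : 'M[R[i]]_m)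
    (hX : thin_svd X U sigma V)
    (k : nat) (k_gt0 : (0 < k)%N) (le_km : (k <= m)%N)
    (sigmak_gt0 : forall j : 'I_m, j.+1 = k -> 0 < sigma 0 j)
    (Uk : 'M[R[i]]_(n, k)) (hUk : Uk = first_cols le_km U)
    (Vk : 'M[R[i]]_(m, k)) (hVk : Vk = first_cols le_km V)
    (Sigmak : 'M[R[i]]_k) (hSigmak : Sigmak = diagC (first_cols le_km sigma))
    (Sk : 'M[R[i]]_k) (hSk : Sk = Uk^t* *m Y *m Vk *m invmx Sigmak)
    (lambda : 'I_k -> R[i]) (Wk : 'M[R[i]]_k)
    (eigW : forall i, Sk *m col i Wk = lambda i *: col i Wk)
    (normW : forall i, norm2 (col i Wk) = 1)
    (Zk : 'M[R[i]]_(n, k)) (hZk : Zk = Uk *m Wk)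
    (r : 'I_k -> R)
    (hr : forall i, r i = norm2 (A *m (Uk *m col i Wk)
                                 - lambda i *: (Uk *m col i Wk))) :
  (forall i, r i = norm2 ((Y *m Vk *m invmx Sigmak) *m col i Wk
                          - lambda i *: col i Zk)) /\
  (forall (S : 'M[R[i]]_n) (alpha : 'rV[R[i]]_n),
     S \in unitmx -> A = S *m diag_mx alpha *m invmx S ->
     forall i, (min_dist (lambda i) alpha <= (kappa2 S * r i)%:E)%E).
Proof.
have UU : Uk^t* *m Uk = 1%:M.
  by rewrite hUk; apply: first_cols_isometry; case: hX.
have AUk : Y *m Vk *m invmx Sigmak = A *m Uk.
  by rewrite hY hVk hSigmak hUk -(svd_truncation _ hX sigmak_gt0) !mulmxA.
split=> [i|S alpha Su AE i].
  by rewrite hr AUk hZk !colE !mulmxA.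
apply: min_dist_le => [|d d0 dle].
  exact: leq_trans (leq_trans k_gt0 le_km) le_mn.
have := bauer_fike_residual (Uk *m col i Wk) Su d0 dle.
by rewrite (norm2_isometry _ UU) normW mulr1 -AE -hr.
Qed.
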